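(* Let $\circledast,\odot$ be proper multiplications on $\mathbb{Z}^d$ which are aligned. Then $d^*_\circledast=d^*_\odot$, i.e. $d^*_\circledast(A)=d^*_\odot(A)$ for every $A\subseteq\mathbb{Z}^d_{\neq 0}$.
   Context: A proper multiplication on $\mathbb{Z}^d$ is a binary operation $\circledast:\mathbb{Z}^d\times\mathbb{Z}^d\to\mathbb{Z}^d$ making $(\mathbb{Z}^d,+)$ an associative (not necessarily commutative or unital) ring without zero divisors; $\mathbb{Z}^d_{\neq0}=\mathbb{Z}^d\setminus\{0\}$. Two proper multiplications $\circledast,\odot$ are aligned if there exist $v,w\in\mathbb{Z}^d_{\neq 0}$ with $x\circledast v\circledast y=x\odot w\odot y$ for all $x,y\in\mathbb{Z}^d$. For $A\subseteq\mathbb{Z}^d_{\neq0}$, the density $d^*_\circledast(A)=\sup\{\alpha\ge 0:\ \text{for every finite } F\subseteq\mathbb{Z}^d_{\neq0}\text{ there is } s\in\mathbb{Z}^d_{\neq0}\text{ with } |(F\circledast s)\cap A|\ge\alpha|F|\}$, where $F\circledast s=\{f\circledast s: f\in F\}$. *)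

(* Defs.v *)
From mathcomp Require Export all_boot all_order all_algebra finmap.
From mathcomp Require Export all_classical all_reals.

Set Implicit Arguments.
Unset Strict Implicit.
Unset Printing Implicit Defensive.

Import Order.TTheory GRing.Theory Num.Theory.

Local Open Scope classical_set_scope.
Local Open Scope fset_scope.
Local Open Scope ring_scope.

Section ProperMultiplication.
Variable d : nat.
Implicit Types mul omul : 'rV[int]_d -> 'rV[int]_d -> 'rV[int]_d.

Definition nonzero_lattice : set 'rV[int]_d := [set x | x != 0].

Definition proper_multiplication mul : Prop :=
  [/\ associative mul,
      left_distributive mul +%R,
      right_distributive mul +%R
    & forall x y, mul x y = 0 -> x = 0 \/ y = 0].

Definition aligned mul omul : Prop :=
  exists v w, [/\ nonzero_lattice v, nonzero_lattice w
    & forall x y, mul (mul x v) y = omul (omul x w) y].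

Definition dilate mul (F : {fset 'rV[int]_d}) (s : 'rV[int]_d) :
    {fset 'rV[int]_d} :=
  [fset mul f s | f in F].

(* For d > 0 the set below contains 0 and is bounded above by 1 (take F a
   singleton), so that the real [sup] is a genuine supremum. *)
Definition density (R : realType) mul (A : set 'rV[int]_d) : R :=
  sup [set alpha : R | 0 <= alpha /\
    forall F : {fset 'rV[int]_d}, {in F, forall f, nonzero_lattice f} ->
    exists2 s, nonzero_lattice s
      & alpha * (#|` F|)%:R <= (#|` [fset x in dilate mul F s | x \in A]|)%:R].

End ProperMultiplication.

(* Main.v *)
Require Import Defs.

Set Implicit Arguments.
Unset Strict Implicit.
Unset Printing Implicit Defensive.

Import GRing.Theory.

Local Open Scope fset_scope.
Local Open Scope classical_set_scope.
Local Open Scope ring_scope.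

(** If [x * v * y = x . w . y] for all [x] and [y], then
    [(F * v) * s = F . (w . s)], and [F * v] has as many elements as [F].
    Hence a dilation of [F * v] witnessing a ratio [alpha] for [*] is a dilation
    of [F] witnessing the same ratio for [.], so the two densities are suprema of
    the same set. *)

Section ProperMultiplicationTheory.
Variables (d : nat) (mul : 'rV[int]_d -> 'rV[int]_d -> 'rV[int]_d).
Hypothesis hmul : proper_multiplication mul.

(** Right multiplication by [v] is additive, and the absence of zero divisors makes its kernel
    trivial. *)
Lemma proper_mulI v : v != 0 -> injective (mul^~ v).
Proof.
case: hmul => _ mulDl _ mul_eq0 v0 x y /= exy.
have /mul_eq0[/eqP|v_eq0] : mul (x - y) v = 0.
- by apply: (addIr (mul y v)); rewrite -mulDl subrK add0r.
- by rewrite subr_eq0 => /eqP.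
- by rewrite v_eq0 eqxx in v0.
Qed.

Lemma proper_mul_neq0 x y : x != 0 -> y != 0 -> mul x y != 0.
Proof.
case: hmul => _ _ _ mul_eq0 /eqP x0 /eqP y0.
by apply/eqP => /mul_eq0[].
Qed.

Lemma card_dilate (F : {fset 'rV[int]_d}) s :
  s != 0 -> #|` dilate mul F s| = #|` F|.
Proof. by move=> s0; rewrite card_imfset //; apply: proper_mulI. Qed.

End ProperMultiplicationTheory.

Lemma aligned_sym d (mul omul : 'rV[int]_d -> 'rV[int]_d -> 'rV[int]_d) :
  aligned mul omul -> aligned omul mul.
Proof. by move=> [v [w [v0 w0 e]]]; exists w, v; split. Qed.

Lemma aligned_dilate d (mul omul : 'rV[int]_d -> 'rV[int]_d -> 'rV[int]_d)
    (v w s : 'rV[int]_d) (F : {fset 'rV[int]_d}) :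
  associative omul ->
  (forall x y, mul (mul x v) y = omul (omul x w) y) ->
  dilate mul (dilate mul F v) s = dilate omul F (omul w s).
Proof.
move=> omulA e; apply/fsetP => x; apply/imfsetP/imfsetP => /=.
- by move=> [_ /imfsetP[f /= fF ->] ->]; exists f => //; rewrite e omulA.
- move=> [f fF ->]; exists (mul f v); first exact: in_imfset.
  by rewrite e omulA.
Qed.

(** Membership in the set whose supremum is [density], isolated so that each inclusion becomes an
    implication. *)
Definition dilation_ratio (R : realType) d
    (mul : 'rV[int]_d -> 'rV[int]_d -> 'rV[int]_d) (A : set 'rV[int]_d)
    (alpha : R) : Prop :=
  0 <= alpha /\
  forall F : {fset 'rV[int]_d}, {in F, forall f, nonzero_lattice f} ->
  exists2 s, nonzero_lattice s
    & alpha * (#|` F|)%:R <= (#|` [fset x in dilate mul F s | x \in A]|)%:R.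

Lemma aligned_dilation_ratio (R : realType) d
    (mul omul : 'rV[int]_d -> 'rV[int]_d -> 'rV[int]_d) (A : set 'rV[int]_d)
    (alpha : R) :
  proper_multiplication mul -> proper_multiplication omul ->
  aligned mul omul ->
  dilation_ratio mul A alpha -> dilation_ratio omul A alpha.
Proof.
move=> hmul homul [v [w [v0 w0 e]]] [alpha0 alphaP]; split=> // F F0.
(* The test set is [dilate mul F v] rather than [F]; it avoids 0 because [v] is nonzero. *)
have [|s s0] := alphaP (dilate mul F v).
  by move=> _ /imfsetP[f /= /F0 f0 ->]; apply: proper_mul_neq0.
rewrite card_dilate // (@aligned_dilate _ _ omul v w) //; last by case: homul.
by exists (omul w s) => //; apply: proper_mul_neq0.
Qed.

Theorem theorem5p1 (R : realType) (d : nat)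
    (mul omul : 'rV[int]_d -> 'rV[int]_d -> 'rV[int]_d)
    (hmul : proper_multiplication mul)
    (homul : proper_multiplication omul)
    (hal : aligned mul omul) :
  forall A : set 'rV[int]_d, A `<=` @nonzero_lattice d ->
    density R mul A = density R omul A.
Proof.
(* Equal sets have equal [sup] by any convention, which covers [d = 0]: no nonzero [s] exists there
   and both sets are empty. Symmetry of alignment gives the second inclusion. *)
move=> A _; congr sup; apply/seteqP; split=> alpha.
- exact: aligned_dilation_ratio.
- by apply: aligned_dilation_ratio => //; apply: aligned_sym.
Qed.
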